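(* Let $K$ be a real closed field with a compatible non-archimedean absolute value and let $S\subset K^n$ be a semialgebraic set. The canonical map $$S_r^{\mathrm{an}}\ \to\ \varprojlim_{\mathscr{F}}\operatorname{Trop}_{r,\mathscr{F}}(S),\qquad x\mapsto\bigl(\operatorname{trop}_{r,\mathscr{F}}(x)\bigr)_{\mathscr{F}}$$ is a homeomorphism, where the limit is taken over all finite families $\mathscr{F}$ in $K[x_1,\dots,x_n]$.
   Context: The absolute value $|\cdot|_K:K\to\mathbb{R}_{\ge0}$ is compatible with the unique order of $K$: $0\le a\le b$ implies $|a|_K\le|b|_K$. A semialgebraic set in $K^n$ is a finite boolean combination of sets $\{f>0\}$ with $f\in K[x_1,\dots,x_n]$. Real analytification of $S$: let $A$ be the coordinate ring of the Zariski closure of $S$ in $\mathbb{A}^n_K$. A signed $K$-seminorm on $A$ is a map $|\cdot|^{\mathrm{sgn}}:A\to\mathbb{R}$ with $|f|^{\mathrm{sgn}}=\operatorname{sgn}(f)|f|_K$ for $f\in K$, $|fg|^{\mathrm{sgn}}=|f|^{\mathrm{sgn}}|g|^{\mathrm{sgn}}$, and $\min(|f|^{\mathrm{sgn}},|g|^{\mathrm{sgn}})\le|f+g|^{\mathrm{sgn}}\le\max(|f|^{\mathrm{sgn}},|g|^{\mathrm{sgn}})$ for all $f,g\in A$. For a signed seminorm $x$ put $\operatorname{sgn}_x(f)=\operatorname{sgn}(|f|_x^{\mathrm{sgn}})$. $S_r^{\mathrm{an}}$ is the set of all signed $K$-seminorms $x$ on $A$ satisfying a semialgebraic description of $S$: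 if $S=\bigcup_i\{\xi:\operatorname{sgn}f_{ij}(\xi)=\epsilon_{ij}\ \forall j\}$ (finite), then $S_r^{\mathrm{an}}=\bigcup_i\{x:\operatorname{sgn}_x(f_{ij})=\epsilon_{ij}\ \forall j\}$ (independent of the description). It carries the coarsest topology making $x\mapsto|f|_x^{\mathrm{sgn}}\in\mathbb{R}$ continuous for every $f\in A$. For $f\in K[x_1,\dots,x_n]$, $|f|_x^{\mathrm{sgn}}$ means the value at the image of $f$ in $A$. For a finite sequence $\mathscr{F}=(f_1,\dots,f_m)$ in $K[x_1,\dots,x_n]$, $\operatorname{trop}_{r,\mathscr{F}}:S_r^{\mathrm{an}}\to\mathbb{R}^m$, $x\mapsto(|f_1|_x^{\mathrm{sgn}},\dots,|f_m|_x^{\mathrm{sgn}})$, and $\operatorname{Trop}_{r,\mathscr{F}}(S)\subset\mathbb{R}^m$ is its image (with the subspace topology). Given another sequence $\mathscr{F}'=(f'_1,\dots,f'_r)$ and a map $\tau:\{1,\dots,m\}\to\{1,\dots,r\}$ with $f'_{\tau(i)}=f_i$ for all $i$, the projection $\mathbb{R}^r\to\mathbb{R}^m$, $(y_j)_j\mapsto(y_{\tau(i)})_i$, induces a map $\operatorname{Trop}_{r,\mathscr{F}'}(S)\to\operatorname{Trop}_{r,\mathscr{F}}(S)$. The inverse limit is over all finite sequences with respect to all these transition maps, with the inverse limit topology. *)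

(* Defs.v *)
From HB Require Import structures.
From mathcomp Require Import all_boot all_order all_algebra.
From mathcomp Require Import generic_quotient ring_quotient.
From mathcomp Require Import boolp classical_sets functions reals.
From mathcomp Require Import topology normedtype.
(* The notations of [mpoly] conflict with those of mathcomp-analysis. *)
From mathcomp Require Import -(notations) mpoly.

Set Implicit Arguments.
Unset Strict Implicit.
Unset Printing Implicit Defensive.

Import Order.TTheory GRing.Theory Num.Theory.
Import numFieldNormedType.Exports.
Local Open Scope classical_set_scope.
Local Open Scope ring_scope.
Local Open Scope quotient_scope.

Notation mpolys K n := (mpoly n K).

Definition mpoly_at (K : comNzRingType) (n : nat) (f : mpolys K n)
  (xi : 'rV[K]_n) : K := meval (fun i => xi 0 i) f.

(* The finite union over i of the finite systems sgn f_ij = eps_ij is encoded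
   by the list over i of the lists over j of the pairs (f_ij, eps_ij). A sign
   eps_ij outside {-1, 0, 1} is harmless: nothing satisfies the condition. *)
Notation description K n := (seq (seq (mpolys K n * int))).

Definition compatible_nonarchimedean_absval (R : realType) (K : rcfType)
    (absK : K -> R) : Prop :=
  [/\ forall a, 0 <= absK a,
      forall a, absK a = 0 <-> a = 0,
      forall a b, absK (a * b) = absK a * absK b,
      forall a b, absK (a + b) <= Num.max (absK a) (absK b)
    & forall a b, 0 <= a -> a <= b -> absK a <= absK b].

Section Semialgebraic.
Variables (K : rcfType) (n : nat).

Inductive semialgebraic : set 'rV[K]_n -> Prop :=
| semialgebraic_gt0 (f : mpolys K n) :
    semialgebraic [set xi | 0 < mpoly_at f xi]
| semialgebraic_setC S : semialgebraic S -> semialgebraic (~` S)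
| semialgebraic_setI S1 S2 :
    semialgebraic S1 -> semialgebraic S2 -> semialgebraic (S1 `&` S2)
| semialgebraic_setU S1 S2 :
    semialgebraic S1 -> semialgebraic S2 -> semialgebraic (S1 `|` S2).

Definition satisfies (sgn : mpolys K n -> int) (D : description K n) : Prop :=
  exists2 C, C \in D & forall f eps, (f, eps) \in C -> sgn f = eps.

Definition described_set (D : description K n) : set 'rV[K]_n :=
  [set xi | satisfies (fun f => sgz (mpoly_at f xi)) D].

Implicit Types D : description K n.

Lemma described_set_cat D1 D2 :
  described_set (D1 ++ D2) = described_set D1 `|` described_set D2.
Proof.
apply/seteqP; split=> xi /=.
  by case=> C; rewrite mem_cat => /orP[] ?; [left|right]; exists C.
by case=> -[C CD ?]; exists C => //; rewrite mem_cat CD ?orbT.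
Qed.

Lemma described_set_cross D1 D2 :
  described_set [seq C1 ++ C2 | C1 <- D1, C2 <- D2] =
  described_set D1 `&` described_set D2.
Proof.
apply/seteqP; split=> xi /=.
  case=> _ /allpairsP[[C1 C2] /= [C1D C2D ->]] H.
  by split; [exists C1|exists C2] => // f e fe;
    apply: H; rewrite mem_cat fe ?orbT.
move=> [[C1 C1D H1] [C2 C2D H2]]; exists (C1 ++ C2).
  by apply/allpairsP; exists (C1, C2).
by move=> f e; rewrite mem_cat => /orP[/H1|/H2].
Qed.

Lemma described_setC D : exists E, ~` described_set D = described_set E.
Proof.
elim: D => [|C D [E DE]].
  by exists [:: [::]]; apply/seteqP; split=> xi // _; [exists [::]|case].
pose B := [seq [:: (c.1, e)] | c <- C,
  e <- [seq e <- [:: -1; 0; 1] | e != c.2]].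
exists [seq C1 ++ C2 | C1 <- B, C2 <- E].
rewrite described_set_cross -DE -[C :: D]cat1s described_set_cat setCU.
congr (_ `&` _); apply/seteqP; split=> xi /=; last first.
  case=> C1 /allpairsPdep[c [e [cC]]]; rewrite mem_filter => /andP[ne _] ->.
  move=> /(_ _ _ (mem_head _ _)) He [C']; rewrite inE => /eqP-> /(_ c.1 c.2).
  by rewrite -surjective_pairing => /(_ cC) ce; move: ne; rewrite -He -ce eqxx.
move=> nC; apply: contrapT => nB; apply: nC; exists C; first exact: mem_head.
move=> f e fC; apply: contrapT => /eqP ne; apply: nB.
exists [:: (f, sgz (mpoly_at f xi))]; last first.
  by move=> ? ?; rewrite inE => /eqP[-> ->].
apply/allpairsPdep; exists (f, e), (sgz (mpoly_at f xi)); split=> //.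
rewrite mem_filter ne !inE /=.
by case: (sgzP (mpoly_at f xi)).
Qed.

Lemma semialgebraic_described (S : set 'rV[K]_n) :
  semialgebraic S -> exists D, S = described_set D.
Proof.
elim=> {S} [f|S _ [D ->]|S1 S2 _ [D1 ->] _ [D2 ->]|S1 S2 _ [D1 ->] _ [D2 ->]].
- exists [:: [:: (f, 1)]]; apply/seteqP; split=> xi /=.
    move=> f0; exists [:: (f, 1)]; first exact: mem_head.
    by move=> g e; rewrite inE => /eqP[-> ->]; rewrite gtr0_sgz.
  case=> C; rewrite inE => /eqP-> /(_ _ _ (mem_head _ _)) /eqP.
  by rewrite sgz_cp0.
- exact: described_setC.
- by exists [seq C1 ++ C2 | C1 <- D1, C2 <- D2]; rewrite described_set_cross.
- by exists (D1 ++ D2); rewrite described_set_cat.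
Qed.

Definition zariski_closure (S : set 'rV[K]_n) : set 'rV[K]_n :=
  [set xi | forall f : mpolys K n,
     (forall eta, S eta -> mpoly_at f eta = 0) -> mpoly_at f xi = 0].

Definition vanishing_ideal (Z : set 'rV[K]_n) : {pred mpolys K n} :=
  fun f => `[< forall xi, Z xi -> mpoly_at f xi = 0 >].

End Semialgebraic.

Section CoordinateRing.
Variables (K : rcfType) (n : nat).

Fact vanishing_ideal_zmod_closed (Z : set 'rV[K]_n) :
  zmod_closed (vanishing_ideal Z).
Proof.
split=> [|f g /asboolP f0 /asboolP g0]; apply/asboolP => xi Zxi.
  exact: meval0.
by rewrite /mpoly_at mevalB [X in X - _]f0 // [X in _ - X]g0 // subrr.
Qed.

HB.instance Definition _ (Z : set 'rV[K]_n) :=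
  GRing.isZmodClosed.Build (mpolys K n) (vanishing_ideal Z)
    (vanishing_ideal_zmod_closed Z).

Lemma vanishing_idealMr (Z : set 'rV[K]_n) (g f : mpolys K n) :
  f \in vanishing_ideal Z -> g * f \in vanishing_ideal Z.
Proof.
move=> /asboolP f0; apply/asboolP => xi Zxi.
by rewrite /mpoly_at mevalM [X in _ * X]f0 // mulr0.
Qed.

Variable S : set 'rV[K]_n.

Definition coordinate_ring : Type :=
  Quotient.quot (vanishing_ideal (zariski_closure S)).

HB.instance Definition _ := Choice.on coordinate_ring.
HB.instance Definition _ := GRing.Zmodule.on coordinate_ring.

Definition coord_pi (f : mpolys K n) : coordinate_ring :=
  \pi_(Quotient.quot (vanishing_ideal (zariski_closure S))) f.

(* [ring_quotient] only provides a ring structure on the quotient by a proper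
   ideal, whereas the vanishing ideal is the whole ring when S is empty. *)
Definition coord_mul (x y : coordinate_ring) : coordinate_ring :=
  coord_pi (repr x * repr y).

Lemma coord_piK x : coord_pi (repr x) = x. Proof. exact: reprK. Qed.

Lemma coord_piE f g :
  (f - g \in vanishing_ideal (zariski_closure S)) <-> coord_pi f = coord_pi g.
Proof. by rewrite Quotient.idealrBE; split=> /eqP. Qed.

Lemma coord_piD f g : coord_pi (f + g) = coord_pi f + coord_pi g.
Proof. exact: Quotient.pi_add. Qed.

Lemma coord_piM f g : coord_pi (f * g) = coord_mul (coord_pi f) (coord_pi g).
Proof.
apply/coord_piE; set f' := repr _; set g' := repr _.
have -> : f * g - f' * g' = g * (f - f') + f' * (g - g').
  by rewrite !mulrBr [g * f]mulrC [g * f']mulrC addrA subrK.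
by apply: rpredD; apply/vanishing_idealMr/coord_piE; rewrite coord_piK.
Qed.

Fact coord_mulA : associative coord_mul.
Proof.
move=> x y z; rewrite -[x]coord_piK -[y]coord_piK -[z]coord_piK -!coord_piM.
by rewrite mulrA.
Qed.

Fact coord_mulC : commutative coord_mul.
Proof.
by move=> x y; rewrite -[x]coord_piK -[y]coord_piK -!coord_piM mulrC.
Qed.

Fact coord_mul1 : left_id (coord_pi 1) coord_mul.
Proof. by move=> x; rewrite -[x]coord_piK -coord_piM mul1r. Qed.

Fact coord_mulDl : left_distributive coord_mul +%R.
Proof.
move=> x y z; rewrite -[x]coord_piK -[y]coord_piK -[z]coord_piK.
by rewrite -coord_piD -!coord_piM -coord_piD mulrDl.
Qed.

HB.instance Definition _ := GRing.Zmodule_isComPzRing.Build coordinate_ring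
  coord_mulA coord_mulC coord_mul1 coord_mulDl.

End CoordinateRing.

Definition signed_seminorm (R : realType) (K : rcfType) (absK : K -> R)
    (A : comPzRingType) (iota : K -> A) (N : A -> R) : Prop :=
  [/\ forall c : K, N (iota c) = (sgz c)%:~R * absK c,
      forall f g, N (f * g) = N f * N g
    & forall f g, Num.min (N f) (N g) <= N (f + g) <= Num.max (N f) (N g)].

Section RealAnalytification.
Variables (R : realType) (K : rcfType) (absK : K -> R) (n : nat).
Variables (S : set 'rV[K]_n) (D : description K n).

Local Notation A := (coordinate_ring S).

(* [D] stands for a semialgebraic description of [S]. It is a parameter because
   the independence of this set from the choice of [D] is itself a theorem.
   As a subspace of the product space, the set carries the coarsest topology
   for which the evaluations at the elements of [A] are continuous. *)
Definition real_analytification : set (prod_topology (fun _ : A => R)) :=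
  [set N : A -> R |
     signed_seminorm absK (fun c => coord_pi S (mpolyC n c)) N /\
     satisfies (fun f => sgz (N (coord_pi S f))) D].

Definition seminorm_at (x : real_analytification) (f : mpolys K n) : R :=
  set_val x (coord_pi S f).

Definition trop (F : seq (mpolys K n)) (x : real_analytification) :
  'rV[R]_(size F) := \row_i seminorm_at x F`_i.
Arguments trop : clear implicits.

Definition Trop (F : seq (mpolys K n)) : set 'rV[R]_(size F) := range (trop F).
Arguments Trop : clear implicits.

Definition trop_in (F : seq (mpolys K n)) (x : real_analytification) : Trop F :=
  SigSub (mem_set (imageT (trop F) x)).
Arguments trop_in : clear implicits.

(* [colsub tau] is the projection (y_j)_j |-> (y_(tau i))_i. *)
Definition inverse_limit_Trop : set (prod_topology (fun F => Trop F)) :=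
  [set y : forall F, Trop F |
     forall (F F' : seq (mpolys K n)) (tau : 'I_(size F) -> 'I_(size F')),
       (forall i, F'`_(tau i) = F`_i) ->
       colsub tau (set_val (y F')) = set_val (y F)].

Fact trop_in_compatible (x : real_analytification) :
  inverse_limit_Trop (fun F => trop_in F x).
Proof.
move=> F F' tau tauE; rewrite !set_valE /=.
by apply/rowP => i; rewrite !mxE tauE.
Qed.

Definition canonical_map (x : real_analytification) : inverse_limit_Trop :=
  SigSub (mem_set (trop_in_compatible x)).

End RealAnalytification.
Arguments real_analytification {R K} absK {n} S D.
Arguments trop {R K} absK {n} S D F x.
Arguments Trop {R K} absK {n} S D F.
Arguments trop_in {R K} absK {n} S D F x.
Arguments inverse_limit_Trop {R K} absK {n} S D.
Arguments canonical_map {R K} absK {n} S D x.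

Definition homeomorphism (X Y : topologicalType) (f : X -> Y) : Prop :=
  continuous f /\ exists g : Y -> X, [/\ cancel f g, cancel g f & continuous g].

(* Main.v *)
Require Import Defs.
From mathcomp Require Import all_boot all_order all_algebra.
From mathcomp Require Import boolp classical_sets functions reals.
From mathcomp Require Import topology normedtype.
From mathcomp Require Import -(notations) mpoly.

Import numFieldNormedType.Exports.

(** A point [y] of the inverse limit is determined by its values [y_[f]] on the
    one-element families: the transition maps {f_i} -> F force the i-th entry
    of [y_F] to be [y_[f_i]]. Each axiom of a signed seminorm, the independence
    of the representative modulo the ideal, and the description of [S] involve
    finitely many polynomials at a time, and on a finite family F they hold
    because [y_F] is the tropicalization of an actual point of the
    analytification. Thus [f |-> y_[f]] is a signed seminorm, which gives the
    inverse map; both topologies are generated by the evaluations. *)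

Import Order.TTheory GRing.Theory Num.Theory.
Local Open Scope classical_set_scope.
Local Open Scope ring_scope.

Section TopologyComplements.
Variable X : topologicalType.

Lemma prod_topology_eval_continuous {I : Type} (T : I -> topologicalType)
  (i : I) : continuous (fun f : prod_topology T => f i).
Proof.
move=> f; have /cvg_sup/(_ i) cvf : f --> f by exact: cvg_id.
exact: (cvg_comp _ _ cvf (@initial_continuous _ _ _ _)).
Qed.

Lemma continuous_prod_topology {I : Type} {T : I -> topologicalType}
    (f : X -> prod_topology T) :
  (forall i, continuous (fun x => f x i)) -> continuous f.
Proof.
by move=> cf x; apply/cvg_sup => i; exact: (continuous_comp_initial (cf i)).
Qed.

Lemma continuous_row {R : topologicalType} {m : nat} (f : X -> 'rV[R]_m) :
  (forall i, continuous (fun x => f x 0 i)) -> continuous f.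
Proof.
move=> cf x A [P xP sPA]; apply: (filterS (P := [set z | _])) => [z|].
  exact: sPA.
(* A row has finitely many entries, so the entrywise conditions hold simultaneously near [x]. *)
by apply: filter_forall => j; apply: filter_forall => i; rewrite (ord1 j);
  apply: cf; exact: xP.
Qed.

End TopologyComplements.

Section InverseLimit.
Variables (R : realType) (K : rcfType) (absK : K -> R) (n : nat).
Variables (S : set 'rV[K]_n) (D : description K n).

Local Notation A := (coordinate_ring S).
Local Notation San := (real_analytification absK S D).
Local Notation lim := (inverse_limit_Trop absK S D).

Lemma seminorm_at_continuous (f : mpolys K n) :
  continuous (fun x : San => seminorm_at x f).
Proof.
move=> x; apply: (@continuous_comp _ _ _ (set_val : San -> _)
  (fun N : prod_topology (fun _ : A => R) => N (coord_pi S f))).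
  exact: initial_continuous.
exact: prod_topology_eval_continuous.
Qed.

Lemma canonical_map_continuous : continuous (canonical_map absK S D).
Proof.
apply: continuous_comp_initial; apply: continuous_prod_topology => F.
apply: continuous_comp_initial; apply: continuous_row => i.
rewrite (_ : (fun x => _) = fun x : San => seminorm_at x F`_i).
  exact: seminorm_at_continuous.
by apply/funext => x; rewrite /= mxE.
Qed.

Definition limit_value (y : lim) (f : mpolys K n) : R :=
  set_val (set_val y [:: f]) 0 0.

Lemma limit_valueE (y : lim) (F : seq (mpolys K n)) (i : 'I_(size F)) :
  set_val (set_val y F) 0 i = limit_value y F`_i.
Proof.
have := set_valP y => /(_ [:: F`_i] F (fun=> i)); rewrite /limit_value => <-.
  by rewrite mxE.
by move=> j; rewrite (ord1 j).
Qed.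

(** The component of [y] at [F] is by definition the image of some [x], which may vary with [F].
    This transfers to [limit_value y] any property of points that involves finitely many
    polynomials. *)
Lemma limit_value_finite (y : lim) (F : seq (mpolys K n)) :
  exists x : San, {in F, forall f, limit_value y f = seminorm_at x f}.
Proof.
have [x _ xy] := set_valP (set_val y F); exists x => f fF.
(* [F] may repeat [f]; its first occurrence suffices, since [limit_value] depends only on the
   polynomial. *)
have fF' : (index f F < size F)%N by rewrite index_mem.
have := limit_valueE y F (Ordinal fF').
by rewrite /= nth_index // => <-; rewrite set_valE -xy mxE /= nth_index.
Qed.

Lemma limit_value_continuous (f : mpolys K n) :
  continuous (fun y : lim => limit_value y f).
Proof.
move=> y; apply: (@continuous_comp _ _ _
  (fun y : lim => set_val (set_val y [:: f])) (fun M : 'rV[R]_1 => M 0 0));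
  last exact: coord_continuous.
apply: (@continuous_comp _ _ _ (fun y : lim => set_val y [:: f]) set_val);
  last exact: initial_continuous.
apply: (@continuous_comp _ _ _ (set_val : lim -> _)
  (fun y => y [:: f])); first exact: initial_continuous.
exact: prod_topology_eval_continuous.
Qed.

Definition limit_seminorm (y : lim) (a : A) : R := limit_value y (repr a).

(** A single point [x] computes the values at [f] and at the chosen representative of its class, and
    [x] only sees classes. *)
Lemma limit_seminormE (y : lim) (f : mpolys K n) :
  limit_seminorm y (coord_pi S f) = limit_value y f.
Proof.
rewrite /limit_seminorm; have [x xy] := limit_value_finite y
  [:: repr (coord_pi S f); f].
by rewrite !xy ?mem_head ?inE ?eqxx ?orbT // /seminorm_at coord_piK.
Qed.

Lemma limit_seminorm_signed (y : lim) :
  signed_seminorm absK (fun c => coord_pi S (mpolyC n c)) (limit_seminorm y).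
Proof.
split=> [c|a b|a b].
- rewrite limit_seminormE; have [x ->] := limit_value_finite y [:: mpolyC n c].
    by have [[xC _ _] _] := set_valP x; exact: xC.
  exact: mem_head.
(* Lifting to representatives turns the axiom into a relation between three polynomials, to be
   checked at one common [x]. *)
- rewrite -[a]coord_piK -[b]coord_piK -[_ * _]coord_piM !limit_seminormE.
  have [x xy] := limit_value_finite y [:: repr a; repr b; repr a * repr b].
  rewrite !xy ?inE ?eqxx ?orbT // /seminorm_at coord_piM.
  by have [[_ xM _] _] := set_valP x; exact: xM.
- rewrite -[a]coord_piK -[b]coord_piK -coord_piD !limit_seminormE.
  have [x xy] := limit_value_finite y [:: repr a; repr b; repr a + repr b].
  rewrite !xy ?inE ?eqxx ?orbT // /seminorm_at coord_piD.
  by have [[_ _ xD] _] := set_valP x; exact: xD.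
Qed.

Lemma limit_seminorm_satisfies (y : lim) :
  satisfies (fun f => sgz (limit_seminorm y (coord_pi S f))) D.
Proof.
(* All polynomials of [D] enter one family, so that the clause [C] satisfied by [x] is also
   satisfied by [y]. *)
have [x xy] := limit_value_finite y [seq c.1 | c <- flatten D].
have [_ [C CD xC]] := set_valP x; exists C => // f eps fC.
rewrite limit_seminormE xy ?(xC _ _ fC) //.
by apply/mapP; exists (f, eps) => //; apply/flattenP; exists C.
Qed.

Definition limit_point (y : lim) : San :=
  SigSub (mem_set (conj (limit_seminorm_signed y) (limit_seminorm_satisfies y))).

Lemma limit_point_continuous : continuous limit_point.
Proof.
apply: continuous_comp_initial; apply: continuous_prod_topology => a.
(* The evaluation at [a] is [limit_value] at [repr a], a polynomial that does not vary with [y]. *)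
exact: limit_value_continuous.
Qed.

Lemma canonical_mapK : cancel (canonical_map absK S D) limit_point.
Proof.
move=> x; apply: val_inj; apply/funext => a.
by rewrite /= /limit_seminorm /limit_value /= mxE /seminorm_at coord_piK.
Qed.

Lemma limit_pointK : cancel limit_point (canonical_map absK S D).
Proof.
move=> y; apply: val_inj; apply: functional_extensionality_dep => F.
apply: val_inj; apply/rowP => i.
by rewrite /= mxE [LHS]limit_seminormE -limit_valueE.
Qed.

End InverseLimit.

Theorem theorem6p14 (R : realType) (K : rcfType) (absK : K -> R) (n : nat)
    (S : set 'rV[K]_n) (D : description K n) :
  compatible_nonarchimedean_absval absK ->
  semialgebraic S ->
  S = described_set D ->
  homeomorphism (canonical_map absK S D).
Proof.
move=> _ _ _; split; first exact: canonical_map_continuous.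
exists (@limit_point R K absK n S D); split.
- exact: canonical_mapK.
- exact: limit_pointK.
- exact: limit_point_continuous.
Qed.
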